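(* Let $X$ be a separable Banach space which is determined by its finite dimensional subspaces. Then every separable Banach space $Y$ that is finitely representable in $X$ is linearly isometric to a closed subspace of $X$.
   Context: Banach spaces are real. A Banach space $X$ is finitely representable (f.r.) in a Banach space $Y$ if for each finite-dimensional subspace $E$ of $X$ and each $\lambda>1$ there is an isomorphism $T$ of $E$ into $Y$ with $\lambda^{-1}\|x\|\le\|T(x)\|\le\lambda\|x\|$ for all $x\in E$. A separable Banach space $X$ is determined by its finite dimensional subspaces (finitely determined) if every separable Banach space $Y$ such that $X$ is f.r. in $Y$ and $Y$ is f.r. in $X$ is isometric to $X$. *)

(* Defs.v *)
From HB Require Import structures.
From mathcomp Require Import all_boot all_order all_algebra.
From mathcomp Require Import all_classical all_reals all_analysis.

Set Implicit Arguments.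
Unset Strict Implicit.
Unset Printing Implicit Defensive.

Import Order.TTheory GRing.Theory Num.Theory.
Import numFieldNormedType.Exports.

Local Open Scope classical_set_scope.
Local Open Scope ring_scope.

(* A real Banach space is a [completeNormedModType R] with [R : realType]. *)

Definition separable (T : topologicalType) : Prop :=
  exists2 D : set T, countable D & dense D.

(* The linear span of a finite family, which need not be free. *)
Definition fin_dim_subspace (R : realType) (X : normedModType R)
    (E : set X) : Prop :=
  exists (n : nat) (e : 'I_n -> X),
    E = [set x | exists c : 'I_n -> R, x = \sum_(i < n) c i *: e i].

(* Maps defined on a subspace are represented by total functions: their values
   outside [E] are irrelevant. *)
Definition linear_on (R : realType) (X Y : normedModType R)
    (E : set X) (T : X -> Y) : Prop :=
  forall (a : R) (u v : X), E u -> E v -> T (a *: u + v) = a *: T u + T v.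

(* The two bounds make [T] a linear homeomorphism of [E] onto [T @` E], i.e.
   an isomorphism of [E] into [Y]. *)
Definition finitely_representable (R : realType)
    (X Y : completeNormedModType R) : Prop :=
  forall (E : set X) (lambda : R), fin_dim_subspace E -> 1 < lambda ->
    exists2 T : X -> Y, linear_on E T &
      forall x, E x -> lambda^-1 * `|x| <= `|T x| /\ `|T x| <= lambda * `|x|.

Definition norm_preserving (R : realType) (X Y : normedModType R)
    (f : X -> Y) : Prop :=
  forall x, `|f x| = `|x|.

(* Isometries between Banach spaces are taken linear; for surjective maps
   between real spaces fixing 0 this is automatic (Mazur-Ulam). *)
Definition isometric (R : realType) (X Y : normedModType R) : Prop :=
  exists f : {linear X -> Y}, norm_preserving f /\ range f = [set: Y].

Definition finitely_determined (R : realType)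
    (X : completeNormedModType R) : Prop :=
  forall Y : completeNormedModType R, separable Y ->
    finitely_representable X Y -> finitely_representable Y X -> isometric Y X.

(* Main.v *)
Require Import Defs.
From HB Require Import structures.
From mathcomp Require Import all_boot all_order all_algebra.
From mathcomp Require Import all_classical all_reals all_analysis.
From mathcomp Require Import ring lra.
Import Order.TTheory GRing.Theory Num.Theory.
Import numFieldNormedType.Exports.
Local Open Scope classical_set_scope.
Local Open Scope ring_scope.

Set Implicit Arguments.
Unset Strict Implicit.
Unset Printing Implicit Defensive.

(** X and Y are amalgamated over an ultrafilter U on the set of maps T : Y -> X
which, for every finite-dimensional E and every l > 1, contains the set of
l-isomorphisms T of E into X.  The formula p (x, y) = lim_U |x + T y| defines a
seminorm on X * Y which restricts to the norms of X and Y.  The completion Z of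
the quotient by its kernel is separable, contains X and Y isometrically, and is
finitely representable in X: on a finite-dimensional subspace p is approximated,
uniformly on the unit sphere by compactness, by the norm |x + T y| for a single
T.  As X is finitely determined, Z is isometric to X, hence Y embeds into X. *)

(** * Quotient by the kernel of a seminorm *)

Record seminorm (R : realType) (V : lmodType R) := Seminorm {
  seminorm_val :> V -> R ;
  seminormD : forall x y, seminorm_val (x + y) <= seminorm_val x + seminorm_val y ;
  seminormZ : forall a x, seminorm_val (a *: x) = `|a| * seminorm_val x }.

Section seminorm_theory.
Context {R : realType} {V : lmodType R} (p : seminorm V).

Lemma seminorm0 : p 0 = 0.
Proof. by rewrite -(scale0r 0) seminormZ normr0 mul0r. Qed.

Lemma seminormN x : p (- x) = p x.
Proof. by rewrite -scaleN1r seminormZ normrN1 mul1r. Qed.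

Lemma seminormBC x y : p (x - y) = p (y - x).
Proof. by rewrite -seminormN opprB. Qed.

Lemma seminorm_ge0 x : 0 <= p x.
Proof.
have := seminormD p x (- x).
by rewrite subrr seminorm0 seminormN -mulr2n pmulrn_lge0.
Qed.

Lemma seminorm_dist x y : `|p x - p y| <= p (x - y).
Proof.
have h (u v : V) : p u - p v <= p (u - v).
  by rewrite lerBlDr -{1}(subrK v u) seminormD.
by rewrite ler_norml lerNl opprB h seminormBC h.
Qed.

Lemma seminorm_triangle y x z : p (x - z) <= p (x - y) + p (y - z).
Proof. by rewrite -{1}(subrK y x) -addrA seminormD. Qed.

Definition seminorm_ker : {pred V} := fun x => p x == 0.

Lemma seminorm_kerE x : (x \in seminorm_ker) = (p x == 0).
Proof. by []. Qed.

Lemma seminorm_ker_zmod_closed : zmod_closed seminorm_ker.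
Proof.
split=> [|x y]; rewrite !seminorm_kerE ?seminorm0// => /eqP px /eqP py.
rewrite eq_le seminorm_ge0 andbT.
by rewrite (le_trans (seminormD p _ _))// seminormN px py addr0.
Qed.

HB.instance Definition _ :=
  GRing.isZmodClosed.Build V seminorm_ker seminorm_ker_zmod_closed.

(** [Quotient.quot] supplies only the additive group. Scaling and norm are defined below through
    [repr]; their independence of the representative is [seminorm_pi_scale] and
    [seminorm_quot_norm_pi]. *)
Definition seminorm_quot := Quotient.quot seminorm_ker.
HB.instance Definition _ := GRing.Zmodule.on seminorm_quot.

Definition seminorm_pi (v : V) : seminorm_quot := \pi%qT v.

Lemma seminorm_pi_eq (u v : V) : seminorm_pi u = seminorm_pi v <-> p (u - v) = 0.
Proof.
split=> [/eqP|uv]; last apply/eqP.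
  by rewrite -[_ == _]Quotient.idealrBE seminorm_kerE => /eqP.
by rewrite -[_ == _]Quotient.idealrBE seminorm_kerE; apply/eqP.
Qed.

Lemma seminorm_pi_repr (z : seminorm_quot) : seminorm_pi (repr z) = z.
Proof. exact: reprK. Qed.

Lemma seminorm_piD : {morph seminorm_pi : x y / x + y}.
Proof. by move=> x y; rewrite /seminorm_pi !piE. Qed.

Definition seminorm_quot_scale (a : R) (z : seminorm_quot) : seminorm_quot :=
  seminorm_pi (a *: repr z).

Lemma seminorm_pi_scale a v :
  seminorm_quot_scale a (seminorm_pi v) = seminorm_pi (a *: v).
Proof.
apply/seminorm_pi_eq; rewrite -scalerBr seminormZ.
by have /seminorm_pi_eq -> := seminorm_pi_repr (seminorm_pi v); rewrite mulr0.
Qed.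

Fact seminorm_quot_scaleA a b z :
  seminorm_quot_scale a (seminorm_quot_scale b z) = seminorm_quot_scale (a * b) z.
Proof. by rewrite -(seminorm_pi_repr z) !seminorm_pi_scale scalerA. Qed.

Fact seminorm_quot_scale1 : left_id 1 seminorm_quot_scale.
Proof. by move=> z; rewrite -(seminorm_pi_repr z) seminorm_pi_scale scale1r. Qed.

Fact seminorm_quot_scaleDr : right_distributive seminorm_quot_scale +%R.
Proof.
move=> a x y; rewrite -(seminorm_pi_repr x) -(seminorm_pi_repr y).
by rewrite -seminorm_piD !seminorm_pi_scale -seminorm_piD scalerDr.
Qed.

Fact seminorm_quot_scaleDl z : {morph seminorm_quot_scale^~ z : a b / a + b}.
Proof.
move=> a b; rewrite -(seminorm_pi_repr z) /= !seminorm_pi_scale.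
by rewrite -seminorm_piD scalerDl.
Qed.

HB.instance Definition _ := GRing.Zmodule_isLmodule.Build R seminorm_quot
  seminorm_quot_scaleA seminorm_quot_scale1 seminorm_quot_scaleDr
  seminorm_quot_scaleDl.

Fact seminorm_pi_linear : linear seminorm_pi.
Proof.
by move=> a u v; rewrite seminorm_piD -seminorm_pi_scale.
Qed.

HB.instance Definition _ :=
  GRing.isLinear.Build R V seminorm_quot _ seminorm_pi seminorm_pi_linear.

Definition seminorm_quot_norm (z : seminorm_quot) : R := p (repr z).

Lemma seminorm_quot_norm_pi v : seminorm_quot_norm (seminorm_pi v) = p v.
Proof.
have /seminorm_pi_eq h := seminorm_pi_repr (seminorm_pi v).
by apply/eqP; rewrite -subr_eq0 -normr_le0 -h seminorm_dist.
Qed.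

Fact seminorm_quot_normD x y :
  seminorm_quot_norm (x + y) <= seminorm_quot_norm x + seminorm_quot_norm y.
Proof.
rewrite -(seminorm_pi_repr x) -(seminorm_pi_repr y) -seminorm_piD.
by rewrite !seminorm_quot_norm_pi seminormD.
Qed.

Fact seminorm_quot_normZ a z :
  seminorm_quot_norm (a *: z) = `|a| * seminorm_quot_norm z.
Proof. by rewrite [a *: z]/(seminorm_pi _) seminorm_quot_norm_pi seminormZ. Qed.

Fact seminorm_quot_norm0_eq0 z : seminorm_quot_norm z = 0 -> z = 0.
Proof.
move=> z0; rewrite -(seminorm_pi_repr z) -(raddf0 seminorm_pi).
by apply/seminorm_pi_eq; rewrite subr0.
Qed.

HB.instance Definition _ := Lmodule_isNormed.Build R seminorm_quot
  seminorm_quot_normD seminorm_quot_normZ seminorm_quot_norm0_eq0.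

Lemma norm_seminorm_pi v : `|seminorm_pi v| = p v.
Proof. exact: seminorm_quot_norm_pi. Qed.

End seminorm_theory.

(** * Completion *)

Definition seminorm_cauchy (R : realType) (V : lmodType R) (p : seminorm V)
    (u : nat -> V) : Prop :=
  forall e, 0 < e ->
    exists N, forall m n, (N <= m)%N -> (N <= n)%N -> p (u m - u n) <= e.

(** Completeness is stated before separation, where limits need not be unique, so that the
    completion can be formed on Cauchy sequences and the kernel divided out once, at the end. *)
Definition seminorm_complete (R : realType) (V : lmodType R) (p : seminorm V) :
    Prop :=
  forall u, seminorm_cauchy p u -> exists v, forall e, 0 < e ->
    exists N, forall n, (N <= n)%N -> p (u n - v) <= e.

Lemma exists_invSn_le (R : realType) (e : R) : 0 < e ->
  exists N : nat, forall n, (N <= n)%N -> n.+1%:R^-1 <= e.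
Proof.
move=> e0; exists (Num.bound e^-1) => n Nn.
rewrite -[leRHS]invrK lef_pV2 ?posrE ?ltr0n ?invr_gt0//.
have /ltW/le_trans := archi_boundP (ltW (etrans (invr_gt0 e) e0)); apply.
by rewrite ler_nat (leq_trans Nn).
Qed.

(** Filter completeness reduces to sequences: a Cauchy filter contains balls of radius [1/(n+1)],
    representatives of their centers form a Cauchy sequence for [p], and the class of a limit of it
    is the limit of the filter. *)
Lemma complete_seminorm_quot (R : realType) (V : lmodType R) (p : seminorm V) :
    seminorm_complete p ->
  exists (Z : completeNormedModType R) (j : {linear V -> Z}),
    (forall v, `|j v| = p v) /\ range j = [set: Z].
Proof.
move=> pc.
have cvgZ (F : set_system (seminorm_quot p)) :
    ProperFilter F -> cauchy F -> cvg F.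
  move=> FF /cauchyP Fc.
  have /choice[z Fz] : forall n : nat, exists z, F (ball z (n.+1%:R^-1 : R)).
    by move=> n; apply: Fc; rewrite invr_gt0 ltr0n.
  (* Two members of a proper filter meet, so two centers are no further apart than the sum of the
     radii. *)
  have pz (m n : nat) : `|z m - z n| <= m.+1%:R^-1 + n.+1%:R^-1.
    have [y []] := filter_ex (filterI (Fz m) (Fz n)).
    rewrite -!ball_normE /= => /ltW my /ltW ny.
    by rewrite (le_trans (ler_distD y _ _))// lerD// distrC.
  have [|v hv] := pc (repr \o z).
    move=> e e0; have [N hN] := exists_invSn_le (divr_gt0 e0 (ltr0n R 2)).
    exists N => m n /hN hm /hN hn; rewrite -norm_seminorm_pi raddfB /=.
    by rewrite !seminorm_pi_repr (le_trans (pz m n))// (splitr e) lerD.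
  apply/cvg_ex; exists (seminorm_pi p v); apply/cvg_ballP => e e0.
  have e20 := divr_gt0 e0 (ltr0n R 2).
  have [N1 h1] := exists_invSn_le e20.
  have [N2 h2] := hv _ e20.
  apply: filterS (Fz (maxn N1 N2)) => y; rewrite -!ball_normE /= => hy.
  rewrite (le_lt_trans (ler_distD (z (maxn N1 N2)) _ _))// (splitr e).
  rewrite ler_ltD//; last by rewrite (lt_le_trans hy)// h1// leq_maxl.
  rewrite distrC -[z _]seminorm_pi_repr -raddfB norm_seminorm_pi.
  by rewrite h2// leq_maxr.
pose c := Uniform_isComplete.Build (seminorm_quot p) cvgZ.
pose Z : completeNormedModType R := HB.pack (seminorm_quot p) c.
exists Z, (seminorm_pi p : {linear V -> seminorm_quot p}); split.
  exact: norm_seminorm_pi.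
by rewrite -subTset => z _; exists (repr z) => //; exact: seminorm_pi_repr.
Qed.

Section cauchy_sequences.
Context {R : realType} {V : lmodType R} (p : seminorm V).

Definition cauchy_pred : {pred nat -> V} := fun u => `[< seminorm_cauchy p u >].

Lemma cauchy_predP u : reflect (seminorm_cauchy p u) (u \in cauchy_pred).
Proof. exact: asboolP. Qed.

Lemma cauchy_pred_submod_closed : submod_closed cauchy_pred.
Proof.
split=> [|a u v /cauchy_predP cu /cauchy_predP cv]; apply/cauchy_predP => e e0.
  by exists 0%N => m n _ _; rewrite subrr seminorm0 ltW.
have e20 := divr_gt0 e0 (ltr0n R 2).
(* The added 1 allows division when [a] is 0. *)
have a0 : 0 < `|a| + 1 by rewrite ltr_wpDl.
have [N1 h1] := cu _ (divr_gt0 e20 a0); have [N2 h2] := cv _ e20.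
exists (maxn N1 N2) => m n; rewrite !geq_max => /andP[m1 m2] /andP[n1 n2].
rewrite [X in p X](_ : _ = a *: (u m - u n) + (v m - v n)); last first.
  by rewrite /= opprD addrACA scalerBr.
rewrite (le_trans (seminormD p _ _))// (splitr e) lerD ?h2// seminormZ.
rewrite (@le_trans _ _ ((`|a| + 1) * p (u m - u n)))//.
  by rewrite ler_wpM2r ?seminorm_ge0// lerDl.
by rewrite mulrC -ler_pdivlMr// h1.
Qed.

HB.instance Definition _ :=
  GRing.isSubmodClosed.Build R (nat -> V) cauchy_pred cauchy_pred_submod_closed.

Record cauchy_seq := CauchySeq {
  cauchy_seq_val :> nat -> V ;
  cauchy_seqP : cauchy_seq_val \in cauchy_pred }.

HB.instance Definition _ := [isSub for cauchy_seq_val].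
HB.instance Definition _ := [Choice of cauchy_seq by <:].
HB.instance Definition _ := [SubChoice_isSubLmodule of cauchy_seq by <:].

Lemma cauchy_seq_cvg (u : cauchy_seq) : cvgn (fun n => p (u n)).
Proof.
apply/cauchy_cvgP/cauchyP => e e0.
have /cauchy_predP/(_ _ (divr_gt0 e0 (ltr0n R 2)))[N hN] := cauchy_seqP u.
exists (p (u N)); exists N => // n /= Nn; rewrite -ball_normE /=.
rewrite (le_lt_trans (seminorm_dist _ _ _))// (le_lt_trans (hN _ _ _ Nn))//.
by rewrite gtr_pMr// invf_lt1 ?ltr1n.
Qed.

Definition cauchy_seq_limit (u : cauchy_seq) : R := limn (fun n => p (u n)).

Fact cauchy_seq_limitD u v :
  cauchy_seq_limit (u + v) <= cauchy_seq_limit u + cauchy_seq_limit v.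
Proof.
rewrite /cauchy_seq_limit -limD; [|exact: cauchy_seq_cvg..].
apply: ler_lim; first exact: cauchy_seq_cvg.
  by apply: is_cvgD; exact: cauchy_seq_cvg.
by apply: nearW => n; exact: seminormD.
Qed.

Fact cauchy_seq_limitZ a u :
  cauchy_seq_limit (a *: u) = `|a| * cauchy_seq_limit u.
Proof.
apply: cvg_lim => //; under eq_fun do rewrite seminormZ.
by apply: cvgM; [exact: cvg_cst|exact: cauchy_seq_cvg].
Qed.

Definition cauchy_seq_seminorm := Seminorm cauchy_seq_limitD cauchy_seq_limitZ.

Fact cst_cauchy (v : V) : (fun=> v) \in cauchy_pred.
Proof.
apply/cauchy_predP => e e0; exists 0%N => m n _ _.
by rewrite subrr seminorm0 ltW.
Qed.

Definition cst_cauchy_seq v := CauchySeq (cst_cauchy v).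

Fact cst_cauchy_seq_linear : linear cst_cauchy_seq.
Proof. by move=> a u v; apply: val_inj; apply/funext. Qed.

HB.instance Definition _ :=
  GRing.isLinear.Build R V cauchy_seq _ cst_cauchy_seq cst_cauchy_seq_linear.

Lemma cauchy_seq_seminorm_cst v : cauchy_seq_seminorm (cst_cauchy_seq v) = p v.
Proof. by rewrite /= /cauchy_seq_limit /= lim_cst. Qed.

(** Constant sequences are dense: the distance from [u] to the constant [u n] is the limit over [m]
    of [p (u n - u m)], which is small for large [n]. *)
Lemma cauchy_seq_tail (u : cauchy_seq) e : 0 < e ->
  exists N, forall n, (N <= n)%N ->
    cauchy_seq_seminorm (cst_cauchy_seq (u n) - u) <= e.
Proof.
move=> e0; have /cauchy_predP/(_ _ e0)[N hN] := cauchy_seqP u.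
exists N => n Nn; apply: limr_le; first exact: cauchy_seq_cvg.
by exists N => // m /= Nm; exact: hN.
Qed.

(** Diagonal argument: [u k] is approximated within [1/(k+1)] by a constant [v k]. The sequence [v]
    is itself Cauchy, hence a point of the space, and it is the limit of [u]. *)
Lemma cauchy_seq_seminorm_complete : seminorm_complete cauchy_seq_seminorm.
Proof.
move=> u uc.
have /choice[v hv] (k : nat) : exists w,
    cauchy_seq_seminorm (cst_cauchy_seq w - u k) <= k.+1%:R^-1.
  have [N hN] := @cauchy_seq_tail (u k) k.+1%:R^-1 ltac:(by rewrite invr_gt0).
  by exists (u k N); exact: hN.
have vc : v \in cauchy_pred.
  apply/cauchy_predP => e e0.
  have e30 := divr_gt0 e0 (ltr0n R 3).
  have [N1 h1] := exists_invSn_le e30; have [N2 h2] := uc _ e30.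
  exists (maxn N1 N2) => m n; rewrite !geq_max => /andP[m1 m2] /andP[n1 n2].
  rewrite -cauchy_seq_seminorm_cst raddfB.
  rewrite (le_trans (seminorm_triangle _ (u m) _ _))//.
  rewrite [leRHS](_ : e = e / 3 + (e / 3 + e / 3)); last by field.
  rewrite lerD ?(le_trans (hv m)) ?h1//.
  rewrite (le_trans (seminorm_triangle _ (u n) _ _))// lerD ?h2//.
  by rewrite seminormBC (le_trans (hv n)) ?h1.
exists (CauchySeq vc) => e e0.
have e20 := divr_gt0 e0 (ltr0n R 2).
have [N1 h1] := exists_invSn_le e20.
have [N2 h2] := cauchy_seq_tail (CauchySeq vc) e20.
exists (maxn N1 N2) => n; rewrite !geq_max => /andP[n1 n2].
rewrite (le_trans (seminorm_triangle _ (cst_cauchy_seq (v n)) _ _))//.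
by rewrite (splitr e) lerD ?h2// seminormBC (le_trans (hv n)) ?h1.
Qed.

Lemma seminorm_completion :
  exists (Z : completeNormedModType R) (j : {linear V -> Z}),
    (forall v, `|j v| = p v) /\
    (forall z e, 0 < e -> exists v, `|z - j v| <= e).
Proof.
have [Z [j [jp jr]]] := complete_seminorm_quot cauchy_seq_seminorm_complete.
exists Z, (j \o cst_cauchy_seq : {linear V -> Z}); split=> [v|z e e0] /=.
  by rewrite jp cauchy_seq_seminorm_cst.
have [u _ <-] : range j z by rewrite jr.
have [N hN] := cauchy_seq_tail u e0.
by exists (u N); rewrite distrC -raddfB jp hN.
Qed.

End cauchy_sequences.

(** * Linear combinations and finite-dimensional subspaces *)

Section linear_combinations.
Context {R : realType} {V : lmodType R}.

Definition lincomb n (e : 'I_n -> V) (c : 'I_n -> R) : V :=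
  \sum_(i < n) c i *: e i.

Definition lincomb_set n (e : 'I_n -> V) : set V :=
  [set x | exists c : 'I_n -> R, x = lincomb e c].

Definition lincomb_free n (e : 'I_n -> V) : Prop :=
  forall c, lincomb e c = 0 -> forall i, c i = 0.

Lemma lincombP n (e : 'I_n -> V) a c d :
  lincomb e (fun i => a * c i + d i) = a *: lincomb e c + lincomb e d.
Proof.
rewrite /lincomb scaler_sumr -big_split /=.
by apply: eq_bigr => i _; rewrite scalerDl scalerA.
Qed.

Lemma lincombZ n (e : 'I_n -> V) a c :
  lincomb e (fun i => a * c i) = a *: lincomb e c.
Proof.
by rewrite /lincomb scaler_sumr; apply: eq_bigr => i _; rewrite scalerA.
Qed.

Lemma lincombB n (e : 'I_n -> V) c d :
  lincomb e (fun i => c i - d i) = lincomb e c - lincomb e d.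
Proof.
by rewrite /lincomb -sumrB; apply: eq_bigr => i _; rewrite scalerBl.
Qed.

Lemma lincomb_vecB n (e f : 'I_n -> V) c :
  lincomb (fun i => e i - f i) c = lincomb e c - lincomb f c.
Proof.
by rewrite /lincomb -sumrB; apply: eq_bigr => i _; rewrite scalerBr.
Qed.

Lemma lincomb_vecD n (e f : 'I_n -> V) c :
  lincomb (fun i => e i + f i) c = lincomb e c + lincomb f c.
Proof.
by rewrite /lincomb -big_split; apply: eq_bigr => i _; rewrite scalerDr.
Qed.

Lemma lincomb_setP n (e : 'I_n -> V) a u v :
  lincomb_set e u -> lincomb_set e v -> lincomb_set e (a *: u + v).
Proof. by move=> [c ->] [d ->]; eexists; rewrite -lincombP. Qed.

Lemma lincomb_set0 n (e : 'I_n -> V) : lincomb_set e 0.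
Proof.
by exists (fun=> 0); rewrite /lincomb big1// => i _; rewrite scale0r.
Qed.

Lemma lincomb_set_vec n (e : 'I_n -> V) i : lincomb_set e (e i).
Proof.
exists (fun k => (k == i)%:R); rewrite /lincomb (bigD1 i)//= eqxx scale1r.
by rewrite big1 ?addr0// => k /negbTE ->; rewrite scale0r.
Qed.

Lemma lincomb_set_drop n (e : 'I_n.+1 -> V) c i :
    lincomb e c = 0 -> c i != 0 ->
  lincomb_set e = lincomb_set (fun k => e (lift i k)).
Proof.
move=> c0 ci; apply/seteqP; split=> x [d ->].
  (* Subtracting [d i / c i] times the relation [lincomb e c = 0] cancels the coefficient of
     [e i]. *)
  exists (fun k => d (lift i k) - d i / c i * c (lift i k)).
  rewrite -[LHS]subr0 -(scaler0 _ (d i / c i)) -c0 -lincombZ -lincombB.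
  by rewrite {1}/lincomb (bigD1_ord i)//= divfK// subrr scale0r add0r.
exists (fun k => if unlift i k is Some l then d l else 0).
rewrite /lincomb (bigD1_ord i)//= unlift_none scale0r add0r.
by apply: eq_bigr => k _; rewrite liftK.
Qed.

End linear_combinations.

Lemma linear_lincomb (R : realType) (V W : lmodType R) (f : {linear V -> W}) n
    (e : 'I_n -> V) c :
  f (lincomb e c) = lincomb (f \o e) c.
Proof. by rewrite /lincomb linear_sum; apply: eq_bigr => i _; rewrite linearZ. Qed.

(** A spanning family of least length is free, since a nontrivial relation would let one vector be
    dropped. *)
Lemma fin_dim_free (R : realType) (V : normedModType R) (E : set V) :
    fin_dim_subspace E ->
  exists n (e : 'I_n -> V), E = lincomb_set e /\ lincomb_free e.
Proof.
pose P n := `[< exists e : 'I_n -> V, E = lincomb_set e >].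
move=> [n0 [e0 E0]]; have exP : exists n, P n by exists n0; apply/asboolP; exists e0.
case: (ex_minnP exP) => -[|n] /asboolP[e Ee] nmin.
  by exists 0%N, e; split => // c _ [].
exists n.+1, e; split => // c c0 i; apply/eqP; apply: contraT => ci.
have /nmin : P n.
  by apply/asboolP; eexists; rewrite Ee (lincomb_set_drop c0 ci).
by rewrite ltnn.
Qed.

Lemma fin_dim_lincomb (R : realType) (V : normedModType R) n (e : 'I_n -> V) :
  fin_dim_subspace (lincomb_set e).
Proof. by exists n, e. Qed.

(** The concatenated family spans [G]. This makes the sets of near-isometries a directed family. *)
Lemma fin_dim_subspace2 (R : realType) (V : normedModType R) (E F : set V) :
    fin_dim_subspace E -> fin_dim_subspace F ->
  exists2 G, fin_dim_subspace G & E `|` F `<=` G.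
Proof.
move=> [n [e ->]] [m [f ->]].
pose g (i : 'I_(n + m)) := match fintype.split i with inl k => e k | inr k => f k end.
have gl k : fintype.split (lshift m k) = inl k := unsplitK (inl k).
have gr k : fintype.split (rshift n k) = inr k := unsplitK (inr k).
exists (@lincomb_set _ _ (n + m) g); first exact: fin_dim_lincomb.
move=> x [] [c ->].
  exists (fun i => match fintype.split i with inl k => c k | inr k => 0 end).
  rewrite /lincomb big_split_ord /=.
  rewrite [X in _ = _ + X]big1 ?addr0 => [|i _]; last by rewrite gr scale0r.
  by apply: eq_bigr => i _; rewrite /g gl.
exists (fun i => match fintype.split i with inl k => 0 | inr k => c k end).
rewrite /lincomb big_split_ord /=.
rewrite [X in _ = X + _]big1 ?add0r => [|i _]; last by rewrite gl scale0r.
by apply: eq_bigr => i _; rewrite /g gr.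
Qed.

Section linear_on_theory.
Context {R : realType} {X Y : normedModType R}.

Lemma linear_on_lincomb n (e : 'I_n -> X) (T : X -> Y) c :
  linear_on (lincomb_set e) T -> T (lincomb e c) = lincomb (T \o e) c.
Proof.
move=> Tl; rewrite /lincomb.
(* The induction carries membership in the span, because [linear_on] says nothing about vectors
   outside it. *)
suff [] : lincomb_set e (lincomb e c) /\
  T (lincomb e c) = \sum_(i < n) c i *: T (e i) by [].
rewrite /lincomb; elim/big_rec2: _ => [|i y x _ [ex Tx]].
  split; first exact: lincomb_set0.
  have := Tl 1 0 0 (lincomb_set0 e) (lincomb_set0 e).
  by rewrite !scale1r addr0 => /(congr1 (fun x => x - T 0)); rewrite addrK subrr.
split; first by apply: lincomb_setP => //; exact: lincomb_set_vec.
by rewrite Tl ?Tx//; exact: lincomb_set_vec.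
Qed.

End linear_on_theory.

(** * Norm estimates for linear combinations, by compactness of the coefficient sphere *)

Definition norm_seminorm (R : realType) (V : normedModType R) : seminorm V :=
  @Seminorm R V (@Num.norm R V) (@ler_normD _ _) (@normrZ _ _).

Lemma coord_le_norm (R : realType) n (c : 'rV[R]_n) i : `|c 0 i| <= `|c|.
Proof.
rewrite [leRHS]/Num.norm /= mx_normrE; apply/bigmax_geP; right => /=.
by exists (0, i).
Qed.

Lemma seminorm_lincomb_le (R : realType) (V : lmodType R) (p : seminorm V) n
    (e : 'I_n -> V) (c : 'rV[R]_n) :
  p (lincomb e (c 0)) <= `|c| * \sum_(i < n) p (e i).
Proof.
rewrite mulr_sumr /lincomb; elim/big_ind2: _ => [|x1 x2 y1 y2 h1 h2|i _].
- by rewrite seminorm0.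
- by rewrite (le_trans (seminormD p _ _))// lerD.
- by rewrite seminormZ ler_wpM2r ?seminorm_ge0 ?coord_le_norm.
Qed.

Lemma unit_sphere_compact (R : realType) n : compact [set c : 'rV[R]_n | `|c| = 1].
Proof.
apply: bounded_closed_compact.
  by exists 1; split => // M M1 c /= ->; exact: ltW.
have -> : [set c : 'rV[R]_n | `|c| = 1] = Num.norm @^-1` [set 1] by [].
by apply: closed_comp; [move=> c _; exact: norm_continuous|exact: closed_eq].
Qed.

(** On the compact unit sphere of coefficients the norm of the combination is continuous and, by
    freeness, positive, so it has a positive lower bound; homogeneity gives the rest. Compactness is
    used as near-covering: a bound valid around each [c0] for all small [m > 0] holds on the whole
    sphere for some [m]. *)
Lemma free_lower_bound (R : realType) (V : normedModType R) n (e : 'I_n -> V) :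
    lincomb_free e ->
  exists2 m, 0 < m & forall c : 'rV[R]_n, m * `|c| <= `|lincomb e (c 0)|.
Proof.
move=> ef; set S := \sum_(i < n) `|e i|.
have S1 : 0 < S + 1 by rewrite ltr_wpDl ?sumr_ge0.
have /compact_near_coveringP cov := @unit_sphere_compact R n.
have : \forall m \near 0^'+,
    [set c : 'rV[R]_n | `|c| = 1] `<=` [set c | m <= `|lincomb e (c 0)|].
  apply: (cov R 0^'+ (fun m c => m <= `|lincomb e (c 0)|)) => c0 /= c01.
  have h0 : 0 < `|lincomb e (c0 0)|.
    rewrite normr_gt0; apply/eqP => /ef c00; move: c01.
    rewrite (_ : c0 = 0) ?normr0; first by move/eqP; rewrite eq_sym oner_eq0.
    by apply/rowP => i; rewrite c00 mxE.
  (* Half of the value at [c0] serves as the local bound; the other half absorbs the change from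
     [c0] to [c]. *)
  have h20 := divr_gt0 h0 (ltr0n R 2).
  have mh := nbhs_right_le h20.
  have d0 := divr_gt0 h20 S1.
  have ch : \forall c \near c0, `|c0 - c| <= `|lincomb e (c0 0)| / 2 / (S + 1).
    by apply: (@cvgr_dist_le _ _ _ (nbhs c0) _ id c0).
  near=> c m.
  rewrite (@le_trans _ _ (`|lincomb e (c0 0)| / 2))//.
    exact: (near mh m).
  have : `|lincomb e (c0 0) - lincomb e (c 0)| <= `|lincomb e (c0 0)| / 2.
    rewrite -lincombB (_ : (fun i => _) = (c0 - c) 0); last first.
      by apply/funext => i; rewrite !mxE.
    rewrite (le_trans (seminorm_lincomb_le (norm_seminorm V) _ _))//=.
    rewrite (@le_trans _ _ (`|c0 - c| * (S + 1)))//.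
      by rewrite ler_wpM2l// lerDl.
    by rewrite -ler_pdivlMr//; exact: (near ch c).
  by have := lerB_dist (lincomb e (c0 0)) (lincomb e (c 0)); lra.
move=> H; have [m [mS m0]] := filter_ex (filterI H (nbhs_right_gt 0)).
exists m => // c; have [->|c0] := eqVneq c 0.
  by rewrite normr0 mulr0.
have cN : 0 < `|c| by rewrite normr_gt0.
have := mS (`|c|^-1 *: c); rewrite /= normfZV// => /(_ erefl).
rewrite (_ : (`|c|^-1 *: c) 0 = fun i => `|c|^-1 * c 0 i); last first.
  by apply/funext => i; rewrite mxE.
by rewrite lincombZ normrZ gtr0_norm ?invr_gt0// ler_pdivlMl// mulrC.
Unshelve. all: by end_near. Qed.

(** * Limits along ultrafilters of near-isometries *)

(** The image filter has a cluster point in the compact segment [[-C, C]], and an ultrafilter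
    converges to each of its cluster points. *)
Lemma ultra_bounded_cvg (R : realType) (T : Type) (U : set_system T)
    (f : T -> R) (C : R) :
  UltraFilter U -> (\forall t \near U, `|f t| <= C) -> cvg (f @ U).
Proof.
move=> UU fC.
have [|x [_ xf]] := @segment_compact R (- C) C (f @ U) _.
  by apply: filterS fC => t; rewrite ler_norml /= in_itv.
apply/cvg_ex; exists x => B xB.
have [//|UnB] := in_ultra_setVsetC (f @^-1` B) UU.
by have [t []] := xf (~` B) B UnB xB.
Qed.

Lemma le_mul_gt1 (R : realType) (a b : R) :
  0 <= b -> (forall l, 1 < l -> a <= l * b) -> a <= b.
Proof.
move=> b0 ab; apply/ler_addgt0Pr => e e0.
have b1 : 0 < b + 1 by rewrite ltr_wpDl.
(* With this [l], [l * b = b + e * b / (b + 1) <= b + e], including when [b] is 0. *)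
rewrite (le_trans (ab (1 + e / (b + 1)) _))// ?ltrDl ?divr_gt0//.
rewrite mulrDl mul1r lerD2l -mulrA ler_piMr ?(ltW e0)//.
by rewrite ler_pdivrMl// mulr1 lerDl.
Qed.

Section near_isometries.
Context {R : realType} {X Y : completeNormedModType R}.

Definition near_isometry (E : set Y) (l : R) (T : Y -> X) : Prop :=
  linear_on E T /\
  forall y, E y -> l^-1 * `|y| <= `|T y| /\ `|T y| <= l * `|y|.

Lemma near_isometry_subset E F l k T : F `<=` E -> 1 < l -> l <= k ->
  near_isometry E l T -> near_isometry F k T.
Proof.
move=> FE l1 lk [Tl Tb]; split=> [a u v /FE Eu /FE Ev|y /FE /Tb[Tlb Tub]].
  exact: Tl.
have l0 := lt_trans ltr01 l1; split.
  by rewrite (le_trans _ Tlb)// ler_wpM2r// lef_pV2// posrE// (lt_le_trans l0).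
by rewrite (le_trans Tub)// ler_wpM2r.
Qed.

(** Finite representability makes each set of near-isometries nonempty, and two of them contain a
    third, taken on a larger subspace with the smaller constant. They therefore form the base of a
    proper filter, which extends to an ultrafilter. *)
Lemma near_isometries_ultrafilter : finitely_representable Y X ->
  exists2 U : set_system (Y -> X), UltraFilter U &
    forall E l, fin_dim_subspace E -> 1 < l ->
      \forall T \near U, near_isometry E l T.
Proof.
move=> fr.
pose D (El : set Y * R) := fin_dim_subspace El.1 /\ 1 < El.2.
pose B (El : set Y * R) := [set T | near_isometry El.1 El.2 T].
have FF : ProperFilter (filter_from D B).
  apply: filter_from_proper => [|[E l] [/= Ed l1]]; last first.
    by have [T Tl Tb] := fr E l Ed l1; exists T.
  apply: filter_from_filter.
    (* The index set is nonempty: the zero subspace with constant 2. *)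
    exists (@lincomb_set R Y 0 (fun=> 0), 2); split=> /=; last by rewrite ltr1n.
    exact: fin_dim_lincomb.
  move=> [E l] [F k] [/= Ed l1] [/= Fd k1].
  have [G Gd EFG] := fin_dim_subspace2 Ed Fd.
  have lk1 : 1 < Num.min l k by rewrite lt_min l1.
  exists (G, Num.min l k); first by [].
  move=> T GT; split; apply: near_isometry_subset GT => //=.
  - by move=> x Ex; apply: EFG; left.
  - by rewrite ge_min lexx.
  - by move=> x Fx; apply: EFG; right.
  - by rewrite ge_min lexx orbT.
have [U [UU FU]] := ultraFilterLemma FF.
by exists U => // E l Ed l1; apply: FU; exists (E, l).
Qed.

Section ultralimit.
Variables (U : set_system (Y -> X)) (UU : UltraFilter U).
Hypothesis U_near : forall E l, fin_dim_subspace E -> 1 < l ->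
  \forall T \near U, near_isometry E l T.

(** The maps [T] are arbitrary outside the chosen subspaces, so every algebraic identity holds only
    for [U]-almost all [T]. It comes from a subspace containing the vectors involved; the constant 2
    is an arbitrary number above 1. *)
Lemma near_lincomb n (y : 'I_n -> Y) c :
  \forall T \near U, T (lincomb y c) = lincomb (T \o y) c.
Proof.
have := U_near (fin_dim_lincomb y) (ltr1n R 2).
by apply: filterS => T [Tl _]; exact: linear_on_lincomb.
Qed.

Lemma near_norm l y : 1 < l ->
  \forall T \near U, l^-1 * `|y| <= `|T y| /\ `|T y| <= l * `|y|.
Proof.
move=> l1; have := U_near (fin_dim_lincomb (fun _ : 'I_1 => y)) l1.
by apply: filterS => T [_]; apply; exact: (lincomb_set_vec _ 0).
Qed.

Lemma near_linear a u v : \forall T \near U, T (a *: u + v) = a *: T u + T v.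
Proof.
have [G Gd uvG] := fin_dim_subspace2 (fin_dim_lincomb (fun _ : 'I_1 => u))
  (fin_dim_lincomb (fun _ : 'I_1 => v)).
have := U_near Gd (ltr1n R 2); apply: filterS => T [Tl _]; apply: Tl; apply: uvG.
  by left; exact: (lincomb_set_vec _ 0).
by right; exact: (lincomb_set_vec _ 0).
Qed.

Definition ultralimit (v : X * Y) : R := lim (`|v.1 + T v.2| @[T --> U]).

Lemma ultralimit_near_le (v : X * Y) :
  \forall T \near U, `|v.1 + T v.2| <= `|v.1| + 2 * `|v.2|.
Proof.
have := near_norm v.2 (ltr1n R 2); apply: filterS => T [_ Tv].
by rewrite (le_trans (ler_normD _ _))// lerD.
Qed.

Lemma ultralimit_cvg (v : X * Y) : cvg (`|v.1 + T v.2| @[T --> U]).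
Proof.
apply: ultra_bounded_cvg (`|v.1| + 2 * `|v.2|) UU _.
by have := ultralimit_near_le v; apply: filterS => T; rewrite normr_id.
Qed.

Fact ultralimitD v w : ultralimit (v + w) <= ultralimit v + ultralimit w.
Proof.
have vw := cvgB (cvgD (@ultralimit_cvg v) (@ultralimit_cvg w))
  (@ultralimit_cvg (v + w)).
rewrite -subr_ge0; apply: (cvgr_to_ge (vw _ _)).
have := near_linear 1 v.2 w.2; apply: filterS => T.
by rewrite !scale1r /= => Tvw; rewrite subr_ge0 Tvw addrACA ler_normD.
Qed.

Fact ultralimitZ a v : ultralimit (a *: v) = `|a| * ultralimit v.
Proof.
apply: cvg_lim => //.
have : `|a| * `|v.1 + T v.2| @[T --> U] --> `|a| * ultralimit v.
  by apply: cvgM; [exact: cvg_cst|exact: ultralimit_cvg].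
move=> av; apply: (cvg_trans _ av); apply: near_eq_cvg.
(* [near_linear] needs a summand: write [a *: v] as [(a - 1) *: v + v]. *)
have := near_linear (a - 1) v.2 v.2; apply: filterS => T.
rewrite scalerBl scale1r subrK /= => ->.
by rewrite scalerBl scale1r subrK -scalerDr normrZ.
Qed.

Definition ultralimit_seminorm := Seminorm ultralimitD ultralimitZ.

Lemma ultralimit_le (v : X * Y) : ultralimit v <= `|v.1| + 2 * `|v.2|.
Proof.
apply: limr_le; first exact: ultralimit_cvg.
exact: ultralimit_near_le.
Qed.

Lemma ultralimit_l x : ultralimit (x, 0) = `|x|.
Proof.
apply: cvg_lim => //=; apply: (cvg_trans _ (@cvg_cst _ `|x| _ U _)).
(* For [U]-almost all [T], [T 0 = 0], because [T 0] has norm at most twice that of 0. *)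
apply: near_eq_cvg; have := near_norm 0 (ltr1n R 2); apply: filterS => T [_].
by rewrite normr0 mulr0 normr_le0 => /eqP ->; rewrite addr0.
Qed.

(** For each [l > 1] the limit lies between [l^-1 * |y|] and [l * |y|]; then [l] tends to 1. *)
Lemma ultralimit_r y : ultralimit (0, y) = `|y|.
Proof.
have c : cvg (`|T y| @[T --> U]).
  by have := @ultralimit_cvg (0, y); under eq_fun do rewrite /= add0r.
rewrite /ultralimit; under eq_fun do rewrite /= add0r.
apply/eqP; rewrite eq_le; apply/andP; split.
  apply: le_mul_gt1 => // l l1; apply: limr_le => //.
  by have := near_norm y l1; apply: filterS => T [].
apply: le_mul_gt1 => [|l l1].
  by apply: limr_ge => //; exact: nearW.
have l0 := lt_trans ltr01 l1.
rewrite -ler_pdivrMl//; apply: limr_ge => //.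
by have := near_norm y l1; apply: filterS => T [].
Qed.

(** One [T] serves all coefficients at once. For a fixed [c] the estimate is the definition of the
    limit; both norms are Lipschitz in [c] with a constant [S] independent of [T], so near-covering
    makes the estimate uniform on the compact unit sphere, and homogeneity extends it to all [c]. *)
Lemma near_lincomb_ultralimit n (v : 'I_n -> X * Y) e : 0 < e ->
  \forall T \near U, forall c : 'rV[R]_n,
    `| `|lincomb (fun i => (v i).1 + T (v i).2) (c 0)|
       - ultralimit (lincomb v (c 0)) | <= e * `|c|.
Proof.
move=> e0; pose g (T : Y -> X) i := (v i).1 + T (v i).2.
pose S := \sum_(i < n) (`|(v i).1| + 2 * `|(v i).2|).
have S1 : 0 < S + 1.
  by rewrite ltr_wpDl// sumr_ge0// => i _; rewrite addr_ge0// mulr_ge0.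
have gS : \forall T \near U, \sum_(i < n) `|g T i| <= S.
  have : \forall T \near U, forall i, `|g T i| <= `|(v i).1| + 2 * `|(v i).2|.
    by apply: filter_forall => i; exact: ultralimit_near_le.
  by apply: filterS => T h; apply: ler_sum.
have pS : \sum_(i < n) ultralimit (v i) <= S.
  by apply: ler_sum => i _; exact: ultralimit_le.
have lin2 c : lincomb v c =
    (lincomb (fun i => (v i).1) c, lincomb (fun i => (v i).2) c).
  rewrite /lincomb; elim/big_rec3: _ => //= i a b d _ ->.
  by rewrite /GRing.add /=.
have /compact_near_coveringP cov := @unit_sphere_compact R n.
have : \forall T \near U, [set c : 'rV[R]_n | `|c| = 1] `<=`
    [set c | `| `|lincomb (g T) (c 0)| - ultralimit (lincomb v (c 0)) | <= e].
  apply: (cov _ U (fun T c =>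
    `| `|lincomb (g T) (c 0)| - ultralimit (lincomb v (c 0)) | <= e)) => c0 /= _.
  (* Three errors of [e / 3]: moving [c] to [c0] in the norm of [X], the limit along [U] at [c0],
     and moving back in the ultralimit. *)
  have e30 := divr_gt0 e0 (ltr0n R 3).
  have d0 := divr_gt0 e30 S1.
  have ch : \forall c \near c0, `|c0 - c| <= e / 3 / (S + 1).
    by apply: (@cvgr_dist_le _ _ _ (nbhs c0) _ id c0).
  have Tc0 : \forall T \near U,
      `|ultralimit (lincomb v (c0 0)) - `|lincomb (g T) (c0 0)| | <= e / 3.
    pose w := lincomb v (c0 0).
    have Tw : \forall T \near U, `|ultralimit w - `|w.1 + T w.2| | <= e / 3.
      exact: cvgr_dist_le (@ultralimit_cvg w) _ e30.
    apply: filterS2 Tw (near_lincomb (fun i => (v i).2) (c0 0)) => T.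
    by rewrite -/w [X in X.1 + T X.2]lin2 /= => + Tc0; rewrite Tc0 lincomb_vecD.
  near=> c T.
  have cc : `|c0 - c| <= e / 3 / (S + 1) := near ch c _.
  have cd : (fun i => c0 0 i - c 0 i) = (c0 - c) 0.
    by apply/funext => i; rewrite !mxE.
  have bnd s : s <= S -> `|c0 - c| * s <= e / 3.
    move=> sS; rewrite (@le_trans _ _ (`|c0 - c| * (S + 1)))//.
      by rewrite ler_wpM2l// (le_trans sS)// lerDl.
    by rewrite -ler_pdivlMr.
  have h1 : `| `|lincomb (g T) (c0 0)| - `|lincomb (g T) (c 0)| | <= e / 3.
    rewrite (le_trans (seminorm_dist (norm_seminorm X) _ _))//.
    rewrite -lincombB cd (le_trans (seminorm_lincomb_le _ _ _))//.
    by apply: bnd; exact: (near gS T).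
  have h2 : `|ultralimit (lincomb v (c0 0)) - ultralimit (lincomb v (c 0))|
      <= e / 3.
    rewrite (le_trans (seminorm_dist ultralimit_seminorm _ _))//.
    rewrite -lincombB cd (le_trans (seminorm_lincomb_le _ _ _))//.
    exact: bnd.
  have h3 : `|ultralimit (lincomb v (c0 0)) - `|lincomb (g T) (c0 0)| | <= e / 3.
    exact: (near Tc0 T).
  by move: h1 h2 h3; rewrite !ler_norml => /andP[? ?] /andP[? ?] /andP[? ?]; lra.
apply: filterS => T TS c; have [->|c0] := eqVneq c 0.
  (* Writing the zero coefficients as multiples of 0 lets [lincombZ] collapse both combinations. *)
  rewrite (_ : (0 : 'rV[R]_n) 0 = fun=> 0 * 0); last first.
    by apply/funext => i; rewrite mxE mulr0.
  rewrite !lincombZ !scale0r !normr0 mulr0.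
  by rewrite [ultralimit 0](seminorm0 ultralimit_seminorm) subr0 normr0.
have cN : 0 < `|c| by rewrite normr_gt0.
have := TS (`|c|^-1 *: c); rewrite /= normfZV// => /(_ erefl).
rewrite (_ : (`|c|^-1 *: c) 0 = fun i => `|c|^-1 * c 0 i); last first.
  by apply/funext => i; rewrite mxE.
rewrite !lincombZ normrZ ultralimitZ -mulrBr normrM.
by rewrite normr_id normfV normr_id ler_pdivrMl// mulrC.
Unshelve. all: by end_near. Qed.

End ultralimit.
End near_isometries.

(** * Amalgamation *)

Lemma dense_approx (R : realType) (V : normedModType R) (D : set V) x e :
  dense D -> 0 < e -> exists2 d, D d & `|x - d| < e.
Proof.
move=> Dd e0; have xe : ball x e !=set0 by exists x; exact: ballxx.
have [d [xd Dd']] := Dd (ball x e) xe (ball_open x e).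
by exists d => //; move: xd; rewrite -ball_normE.
Qed.

(** If [f (y n)] tends to [x], then [y] is Cauchy because [f] preserves distances; completeness of
    [Y] gives a limit, which [f] sends to [x]. *)
Lemma linear_isometry_closed_range (R : realType) (Y : completeNormedModType R)
    (X : normedModType R) (f : {linear Y -> X}) :
  norm_preserving f -> closed (range f).
Proof.
move=> fN x xf.
have fz (n : nat) : exists y, `|x - f y| < n.+1%:R^-1.
  have [|_ [[y _ <-]]] := xf (ball x n.+1%:R^-1).
    by apply: nbhsx_ballx; rewrite invr_gt0.
  by rewrite -ball_normE; exists y.
have [y hy] := choice fz.
have yc : cvg (y @ \oo).
  apply/cauchy_cvgP/cauchyP => e e0; have e20 := divr_gt0 e0 (ltr0n R 2).
  have [N hN] := exists_invSn_le e20.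
  exists (y N); exists N => // n /= Nn.
  rewrite -ball_normE /= -fN raddfB (le_lt_trans (ler_distD x _ _))// (splitr e).
  rewrite distrC ltrD//; first exact: lt_le_trans (hy N) (hN _ (leqnn N)).
  exact: lt_le_trans (hy n) (hN _ Nn).
exists (lim (y @ \oo)) => //; apply/eqP; rewrite eq_sym -subr_eq0 -normr_le0.
apply/ler_addgt0Pr => e e0; rewrite add0r.
have e20 := divr_gt0 e0 (ltr0n R 2).
have [N hN] := exists_invSn_le e20.
have ln : \forall n \near \oo, `|lim (y @ \oo) - y n| <= e / 2.
  exact: cvgr_dist_le yc _ e20.
have [n [/= yn Nn]] := filter_ex (filterI ln (nbhs_infty_ge N)).
rewrite (le_trans (ler_distD (f (y n)) _ _))// (splitr e) lerD//.
  exact: le_trans (ltW (hy n)) (hN _ Nn).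
by rewrite -raddfB fN distrC.
Qed.

Lemma finitely_representable_isometry (R : realType) (X Z : completeNormedModType R)
    (f : {linear X -> Z}) :
  norm_preserving f -> finitely_representable X Z.
Proof.
move=> fN E l _ l1; exists f => [a u v _ _|x _]; first by rewrite linearP.
have l0 := lt_trans ltr01 l1.
rewrite fN; split; last by rewrite ler_peMl// ltW.
by rewrite ler_piMl// invf_le1// ltW.
Qed.

Section amalgamation.
Context {R : realType} {X Y : completeNormedModType R}.

(** [Z] is the completion of [X * Y] under the ultralimit seminorm. To represent the span of a free
    family [e] of [Z] in [X], each [e i] is approximated by some [j (v i)] and sent to
    [(v i).1 + T (v i).2], for one [T] that nearly realizes the seminorm on all combinations of
    [v]. *)
Lemma amalgamation : finitely_representable Y X ->
  exists (Z : completeNormedModType R) (j : {linear (X * Y)%type -> Z}),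
    [/\ forall x, `|j (x, 0)| = `|x|, forall y, `|j (0, y)| = `|y|,
        forall z e, 0 < e -> exists v, `|z - j v| <= e &
        finitely_representable Z X].
Proof.
move=> /near_isometries_ultrafilter[U UU U_near].
pose p := ultralimit_seminorm UU U_near.
have [Z [j [jp jd]]] := seminorm_completion p.
exists Z, j; split => //.
- by move=> x; rewrite jp; exact: ultralimit_l.
- by move=> y; rewrite jp; exact: ultralimit_r.
move=> _ l /fin_dim_free[n [e [-> ef]]] l1.
have l0 := lt_trans ltr01 l1.
have [m m0 me] := free_lower_bound ef.
(* A relative error [k] suffices: [1 - k] is [l^-1], and [1 + k <= l] because the difference is
   [(l - 1)^2 / l]. *)
pose k := 1 - l^-1.
have k0 : 0 < k by rewrite subr_gt0 invf_lt1.
have kl : 1 + k <= l.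
  rewrite /k -subr_ge0 (_ : _ - _ = (l - 1) ^+ 2 / l) ?divr_ge0 ?sqr_ge0 ?ltW//.
  by field; rewrite gt_eqF.
(* Replacing [e] by [j \o v] and replacing the seminorm by the norm under [T] each cost
   [k * m / 2 * |c|]; the sum is at most [k] times the norm of the combination, by the choice of
   [m]. The first cost is shared among the [n] vectors, with [n + 1] as a nonzero divisor. *)
have km0 : 0 < k * m / 2 by rewrite divr_gt0 ?mulr_gt0.
have n0 : 0 < n%:R + 1 :> R by rewrite ltr_wpDl.
have [v hv] := choice (fun i => jd (e i) _ (divr_gt0 km0 n0)).
have [T hT] := filter_ex (near_lincomb_ultralimit UU U_near v km0).
pose g c := lincomb (fun i => (v i).1 + T (v i).2) c.
have ge (c : 'rV[R]_n) :
    `| `|g (c 0)| - `|lincomb e (c 0)| | <= k * `|lincomb e (c 0)|.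
  have := hT c; rewrite -/(g _).
  have : `| ultralimit U (lincomb v (c 0)) - `|lincomb e (c 0)| |
      <= k * m / 2 * `|c|.
    rewrite -[ultralimit _ _]jp linear_lincomb.
    rewrite (le_trans (seminorm_dist (norm_seminorm Z) _ _))//.
    rewrite -lincomb_vecB (le_trans (seminorm_lincomb_le _ _ _))//= mulrC.
    rewrite ler_wpM2r//.
    rewrite (@le_trans _ _ (\sum_(i < n) (k * m / 2 / (n%:R + 1))))//.
      by apply: ler_sum => i _; rewrite distrC.
    rewrite sumr_const card_ord -[leLHS]mulr_natr -[leLHS]mulrA ler_piMr ?(ltW km0)//.
    by rewrite ler_pdivrMl// mulr1 lerDl.
  have := me c; rewrite -(ler_pM2l k0) !ler_norml.
  by move=> h /andP[? ?] /andP[? ?]; lra.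
(* [co] picks coordinates with respect to [e], with the default 0 outside the span. *)
have /choice[co hco] (z : Z) : exists c, lincomb_set e z -> z = lincomb e c.
  by have [[c zc]|nz] := pselect (lincomb_set e z); [exists c|exists (fun=> 0)].
exists (g \o co) => [a u w Eu Ew|z Ez] /=.
  (* Coordinates depend linearly on the vector because freeness makes them unique. *)
  rewrite -lincombP; congr (lincomb _ _); apply/funext => i; apply/eqP.
  rewrite -subr_eq0; apply/eqP; move: i; apply: ef.
  by rewrite lincombB lincombP -!hco ?subrr//; exact: lincomb_setP.
have := ge (\row_i co z i).
rewrite (_ : (\row_i co z i) 0 = co z); last by apply/funext => i; rewrite mxE.
rewrite -(hco z Ez) ler_norml lerNl opprB !lerBlDr => /andP[h1 h2].
split; last by rewrite (le_trans h2)// -{2}[`|z|]mul1r -mulrDl addrC ler_wpM2r.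
by rewrite -[l^-1](subKr 1) -/k mulrBl mul1r lerBlDl.
Qed.
End amalgamation.

Theorem fact2p3 (R : realType) (X : completeNormedModType R)
    (X_separable : separable X) (X_determined : finitely_determined X)
    (Y : completeNormedModType R) (Y_separable : separable Y)
    (Y_fr_X : finitely_representable Y X) :
  exists f : {linear Y -> X}, norm_preserving f /\ closed (range f).
Proof.
have [Z [j [jl jr jd Z_fr_X]]] := amalgamation Y_fr_X.
have lX : linear (fun x : X => j (x, 0)).
  move=> a u v; rewrite -linearP; congr (j _); congr pair.
  by rewrite /= scaler0 addr0.
have lY : linear (fun y : Y => j (0, y)).
  move=> a u v; rewrite -linearP; congr (j _); congr pair.
  by rewrite /= scaler0 addr0.
pose jX : {linear X -> Z} := HB.pack (fun x : X => j (x, 0))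
  (GRing.isLinear.Build R X Z _ _ lX).
pose jY : {linear Y -> Z} := HB.pack (fun y : Y => j (0, y))
  (GRing.isLinear.Build R Y Z _ _ lY).
have jE v : j v = jX v.1 + jY v.2.
  rewrite /= -raddfD; congr (j _); case: v => x y.
  by congr pair; rewrite /= ?addr0 ?add0r.
have Z_separable : separable Z.
  have [DX DXc DXd] := X_separable; have [DY DYc DYd] := Y_separable.
  (* A point of [Z] is within [e / 3] of some [j v], and each of the two coordinates of [v] is moved
     into its dense set at a cost of [e / 3], since [jX] and [jY] preserve norms. *)
  exists (j @` (DX `*` DY)).
    by apply: (sub_countable (card_image_le _ _)); exact: countableX.
  move=> O [z Oz] oO.
  have /nbhs_ballP[e /= e0 eO] := open_nbhs_nbhs (conj oO Oz).
  have e30 := divr_gt0 e0 (ltr0n R 3).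
  have [v zv] := jd z _ e30.
  have [x DXx vx] := dense_approx v.1 DXd e30.
  have [y DYy vy] := dense_approx v.2 DYd e30.
  exists (j (x, y)); split; last by exists (x, y).
  apply: eO; rewrite -ball_normE /=.
  rewrite (le_lt_trans (ler_distD (j v) _ _))//.
  rewrite [ltRHS](_ : e = e / 3 + (e / 3 + e / 3)); last by field.
  rewrite ler_ltD// -linearB jE (le_lt_trans (ler_normD _ _))//.
  by rewrite ltrD// /= ?jl ?jr.
have X_fr_Z : finitely_representable X Z by apply: (@finitely_representable_isometry _ _ _ jX).
have [h [hN _]] := X_determined Z Z_separable X_fr_Z Z_fr_X.
pose f : {linear Y -> X} := h \o jY.
have fN : norm_preserving f by move=> y; rewrite /= hN; exact: jr.
by exists f; split => //; exact: linear_isometry_closed_range.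
Qed.
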